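(* For every $n\ge2$, \[\sum_{\pi\in\mathrm{PF}(n)}(-1)^{\mathrm{cosum}(\pi)}t^{\mathrm{exced}(\pi)}=\sum_{w\in\mathrm{Alt}_n}t^{\mathrm{des}_1(w^{-1})+1}.\]
   Context: $\mathrm{PF}(n)$ is the set of parking functions of length $n$: sequences $\pi=(\pi_1,\dots,\pi_n)$ of positive integers whose weakly increasing rearrangement $c_1\le\dots\le c_n$ satisfies $c_j\le j$ for all $j$. $\mathrm{cosum}(\pi)=\binom{n+1}{2}-\sum_i\pi_i$ and $\mathrm{exced}(\pi)=|\{i\in[n]:\pi_i>i\}|$. A permutation $w\in\mathfrak S_n$ is up-down alternating if $w(1)<w(2)>w(3)<w(4)>\cdots$; $\mathrm{Alt}_n$ is the set of these. A big descent of $v\in\mathfrak S_n$ is an index $i\in[n-1]$ with $v(i)>v(i+1)+1$, and $\mathrm{des}_1(v)$ is the number of big descents. *)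

(* Defs.v *)
From mathcomp Require Import all_boot all_order all_fingroup all_algebra.

Set Implicit Arguments.
Unset Strict Implicit.
Unset Printing Implicit Defensive.

(* With 0-based positions, c_j <= j reads nth 0 c j <= j.+1; the values
   themselves are not shifted. *)
Definition parking (s : seq nat) : bool :=
  all (fun x => 0 < x) s &&
  [forall j : 'I_(size s), nth 0 (sort leq s) j <= j.+1].

Lemma parking_leq (s : seq nat) x : parking s -> x \in s -> x <= size s.
Proof.
case/andP=> _ /forallP parks; rewrite -(mem_sort leq) => /(nthP 0)[i].
rewrite size_sort => lt_i <-; exact: leq_trans (parks (Ordinal lt_i)) lt_i.
Qed.

Lemma parking_sumn (s : seq nat) : parking s -> sumn s <= 'C((size s).+1, 2).
Proof.
case/andP=> _ /forallP parks.
rewrite -(perm_sumn (permEl (perm_sort leq s))) sumnE (big_nth 0) size_sort.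
rewrite big_mkord -bin2_sum big_nat_recl // add0n big_mkord.
by apply: leq_sum => i _; exact: parks.
Qed.

(* By parking_leq, bounding the entries by n excludes no parking function. *)
Definition PF (n : nat) : {set n.-tuple 'I_n.+1} :=
  [set p : n.-tuple 'I_n.+1 | parking [seq val x | x <- p]].

(* By parking_sumn, the subtraction does not truncate on PF n. *)
Definition cosum (n : nat) (p : n.-tuple 'I_n.+1) : nat :=
  'C(n.+1, 2) - \sum_(i < n) tnth p i.

(* i : 'I_n stands for the position i.+1. *)
Definition exced (n : nat) (p : n.-tuple 'I_n.+1) : nat :=
  #|[set i : 'I_n | i.+1 < tnth p i]|.

(* Permutations act on {0, ..., n-1}: shifting both positions and values by one
   preserves order and differences, but swaps the parity of positions. *)
Definition Alt (n : nat) : {set 'S_n} :=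
  [set w : 'S_n | [forall i : 'I_n, forall j : 'I_n,
     (j == i.+1 :> nat) ==> (if odd i then w j < w i else w i < w j)]].

Definition des1 (n : nat) (v : 'S_n) : nat :=
  #|[set i : 'I_n | [exists j : 'I_n, (j == i.+1 :> nat) && ((v j).+1 < v i)]]|.

(* Main.v *)
Require Import Defs.
From mathcomp Require Import all_boot all_order all_fingroup all_algebra.
From mathcomp Require Import zify ring.

(* The polynomials t^d, d <= n, are determined by the numbers C(m + n - d, n),
   m >= 0 (the coefficients of t^d / (1 - t)^(n+1)).  After this substitution
   both sides equal the number of zigzag maps f(1) <= f(2) >= f(3) <= ... from
   [n] to [m].

   Alternating permutations: this is the theory of P-partitions for the zigzag
   poset with a natural labelling for which the label descents of w^-1 are
   exactly its big descents.

   Parking functions: by Vandermonde it suffices to know, for every T, the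
   signed number Q(T) of parking functions whose excedances lie in T.  Reading
   the level sets {i : p_i <= l} for l = 1, ..., n, the partial signed sums
   depend only on the cardinality l + e of the level set, and equal
   (-1)^e sum_y z_l(y) C(y + e, e), where z_l(y) >= 0 counts sequences
   y_1, ..., y_l = y with y_i + y_{i+1} < |T \cap [i]|.  So Q(T) = sum_y z_n(y),
   which is the number of surjective zigzag maps onto [|T|] in which T is the
   set of first occurrences of values; summing C(m, |T|) Q(T) over T gives the
   number of all zigzag maps to [m]. *)

Set Implicit Arguments.
Unset Strict Implicit.
Unset Printing Implicit Defensive.

(** * Binomial sums *)

Lemma sum_bin_shift a n m : a <= n ->
  \sum_(x < m) 'C(x + a, n) = 'C(m + a, n.+1).
Proof.
move=> le_an; elim: m => [|m IHm]; first by rewrite big_ord0 bin_small.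
by rewrite big_ord_recr /= IHm addSn binS.
Qed.

(** Both sides are the multinomial coefficient (n+y)! / (y! e! (n-e)!). *)
Lemma bin_trinomial (n y e : nat) : e <= n ->
  'C(n + y, e + y) * 'C(y + e, e) = 'C(n + y, y) * 'C(n, e).
Proof.
move=> le_en.
have le_eyn : (e + y <= n + y)%N by rewrite leq_add2r.
have facts : (0 < y`! * (e`! * (n - e)`!))%N by rewrite !muln_gt0 !fact_gt0.
apply/eqP; rewrite -(eqn_pmul2r facts); apply/eqP.
have F1 := bin_fact le_eyn; rewrite subnDr in F1.
have F2 := bin_fact (leq_addl y e); rewrite addnK (addnC y) in F2.
have F3 := bin_fact (leq_addl n y); rewrite addnK in F3.
have F4 := bin_fact le_en.
transitivity ((n + y)`!); last by rewrite -F3 -F4; ring.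
by rewrite -F1 -F2 (addnC y); ring.
Qed.

(** Both sides count the sets of y+l+1 among p+q points in a row whose element with y others before
    it lies in the first p: on the left by its position v, on the right by the number i <= l of
    elements among the last q. *)
Lemma sum_bin_position p q y l :
  \sum_(v < p) 'C(v, y) * 'C(p + q - v.+1, l)
  = \sum_(i < l.+1) 'C(q, i) * 'C(p, y + l.+1 - i).
Proof.
elim: p q => [|p IHp] q.
  rewrite big_ord0 big1 // => i _.
  by rewrite bin0n subn_eq0 leqNgt (leq_trans (ltn_ord i)) ?leq_addl ?muln0.
rewrite big_ord_recr /= addSn subSS addKn -addnS IHp.
rewrite [in LHS]big_ord_recl [in LHS]/= bin0 mul1n subn0.
under eq_bigr => i _ do rewrite /bump /= add1n binS mulnDl.
rewrite big_split /= addnA -addnA.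
have -> : (\sum_(i < l) 'C(q, i) * 'C(p, y + l.+1 - i.+1) + 'C(p, y) * 'C(q, l)
  = \sum_(i < l.+1) 'C(q, i) * 'C(p, y + l - i))%N.
  rewrite big_ord_recr /= addnK mulnC; congr (_ + _)%N.
  by apply: eq_bigr => i _; rewrite addnS subSS.
have -> : ('C(p, y + l.+1) + \sum_(i < l) 'C(q, i.+1) * 'C(p, y + l.+1 - i.+1)
  = \sum_(i < l.+1) 'C(q, i) * 'C(p, y + l.+1 - i))%N.
  by rewrite big_ord_recl /= bin0 mul1n subn0.
rewrite -big_split /=; apply: eq_bigr => i _.
by rewrite addnS subSn ?(leq_trans (leq_ord i)) ?leq_addl // binS mulnDr.
Qed.

(** * Sequences with a local constraint *)

Fixpoint chains (m : nat) (r : nat -> rel nat) (n x : nat) : nat :=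
  if n is n'.+1 then \sum_(y < m | r n' y x) chains m r n' y else 1.

Definition is_chain (r : nat -> rel nat) n m (f : {ffun 'I_n.+1 -> 'I_m}) : bool :=
  [forall i : 'I_n, r i (f (widen_ord (leqnSn n) i)) (f (lift ord0 i))].

Definition ffun_rcons (T : finType) n (g : {ffun 'I_n -> T}) (x : T) : {ffun 'I_n.+1 -> T} :=
  [ffun i => oapp g x (unlift ord_max i)].

Lemma ffun_rcons_max (T : finType) n (g : {ffun 'I_n -> T}) x : ffun_rcons g x ord_max = x.
Proof. by rewrite ffunE unlift_none. Qed.

Lemma ffun_rcons_widen (T : finType) n (g : {ffun 'I_n -> T}) x i :
  ffun_rcons g x (widen_ord (leqnSn n) i) = g i.
Proof.
rewrite ffunE (_ : widen_ord _ i = lift ord_max i) ?liftK //.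
by apply: val_inj; rewrite /= /bump leqNgt ltn_ord.
Qed.

Lemma sum_ffun_rcons (T : finType) n (F : {ffun 'I_n.+1 -> T} -> nat) :
  \sum_f F f = \sum_x \sum_(g : {ffun 'I_n -> T}) F (ffun_rcons g x).
Proof.
rewrite pair_big /=.
rewrite (reindex (fun p : T * {ffun 'I_n -> T} => ffun_rcons p.2 p.1)) //=.
exists (fun f => (f ord_max, [ffun i => f (widen_ord (leqnSn n) i)])) => [[x g] _ | f _] /=.
  rewrite ffun_rcons_max; congr (_, _); apply/ffunP=> i.
  by rewrite [LHS]ffunE ffun_rcons_widen.
apply/ffunP=> i; rewrite ffunE.
case: unliftP => [j|] -> //=; rewrite ffunE; congr (f _).
by apply: val_inj; rewrite /= /bump leqNgt ltn_ord.
Qed.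

Lemma is_chain_rcons (r : nat -> rel nat) n m (g : {ffun 'I_n.+1 -> 'I_m}) x :
  is_chain r (ffun_rcons g x) = is_chain r g && r n (g ord_max) x.
Proof.
apply/forallP/andP => [chg | [/forallP chg rx] i].
  split; first apply/forallP=> i.
    have := chg (widen_ord (leqnSn n) i); rewrite ffun_rcons_widen.
    rewrite (_ : lift _ (widen_ord _ _) = widen_ord (leqnSn n.+1) (lift ord0 i));
      last exact: val_inj.
    by rewrite ffun_rcons_widen.
  have := chg ord_max; rewrite ffun_rcons_widen (_ : lift _ _ = ord_max) ?ffun_rcons_max //.
  exact: val_inj.
have [->|/eqP ne_i] := eqVneq i ord_max.
  rewrite ffun_rcons_widen (_ : lift _ _ = ord_max) ?ffun_rcons_max //; exact: val_inj.
have lt_i : i < n.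
  by have := ltn_ord i; rewrite ltnS leq_eqVlt => /orP[/eqP e|//]; case: ne_i; apply: val_inj.
have := chg (Ordinal lt_i).
rewrite ffun_rcons_widen.
rewrite (_ : lift ord0 i = widen_ord (leqnSn n.+1) (lift ord0 (Ordinal lt_i)));
  last exact: val_inj.
by rewrite ffun_rcons_widen (_ : widen_ord _ (Ordinal lt_i) = i) //; apply: val_inj.
Qed.

Lemma card_chains (r : nat -> rel nat) n m :
  #|[set f : {ffun 'I_n.+1 -> 'I_m} | is_chain r f]| = \sum_(x < m) chains m r n x.
Proof.
(* The count is refined by the last value, which is all that the next step of the chain depends
   on. *)
have E : forall x : 'I_m,
    \sum_(f : {ffun 'I_n.+1 -> 'I_m} | is_chain r f && (f ord_max == x)) 1 = chains m r n x.
  elim: n => [|n IHn] x.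
    rewrite big_mkcond sum_ffun_rcons (bigD1 x) //= [X in _ + X]big1 => [|y ne_yx]; last first.
      by rewrite big1 // => g _; rewrite ffun_rcons_max (negPf ne_yx) andbF.
    rewrite addn0 (eq_bigr (fun=> 1)) => [|g _].
      by rewrite sum1_card card_ffun !card_ord.
    rewrite ffun_rcons_max eqxx andbT ifT //; by apply/forallP => -[].
  rewrite big_mkcond sum_ffun_rcons (bigD1 x) //= [X in _ + X]big1 => [|y ne_yx]; last first.
    by rewrite big1 // => g _; rewrite ffun_rcons_max (negPf ne_yx) andbF.
  rewrite addn0 -big_mkcond.
  rewrite (eq_bigl (fun g => is_chain r g && r n (g ord_max) x)) => [|g]; last first.
    by rewrite is_chain_rcons ffun_rcons_max eqxx andbT.
  rewrite (partition_big (fun g : {ffun 'I_n.+1 -> 'I_m} => g ord_max) (fun y => r n y x));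
    last by move=> g /andP[].
  apply: eq_bigr => y ryx; rewrite -IHn; apply: eq_bigl => g.
  by case: eqP => [->|]; rewrite ?ryx ?andbT ?andbF.
rewrite -sum1dep_card (partition_big (fun f : {ffun 'I_n.+1 -> 'I_m} => f ord_max) predT) //=.
by apply: eq_bigr => x _; rewrite E.
Qed.

(** Adding to each value the number of weak steps before it makes every step strict; the values
    before x then form an arbitrary n-subset. *)
Lemma chains_sorted m (s : pred nat) n x : x < m ->
  chains m (fun i y z => if s i then y < z else y <= z) n x
  = 'C(x + \sum_(i < n) ~~ s i, n).
Proof.
elim: n x => [|n IHn] x lt_xm; first by rewrite big_ord0 bin0.
rewrite big_ord_recr /=.
set a := \sum_(i < n) _.
have le_an : a <= n.
  rewrite -[n in leqRHS]card_ord -sum1_card; apply: leq_sum => i _; exact: leq_b1.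
(* As [y <= x] means [y < x + 1], both kinds of step have the bound [x + ~~ s n]. *)
transitivity (\sum_(y < x + ~~ s n) 'C(y + a, n)).
  have le_m : x + ~~ s n <= m by case: (s n); rewrite ?addn0 ?addn1 // ltnW.
  rewrite (big_ord_widen _ (fun y => 'C(y + a, n)) le_m); apply: eq_big => [y|y _].
    by case: (s n); rewrite /= ?addn0 ?addn1.
  by rewrite IHn.
by rewrite sum_bin_shift // addnAC addnA.
Qed.

(** * Zigzag chains grouped by their set of first occurrences *)

Definition count_below n (T : {set 'I_n}) (j : nat) : nat := #|[set i in T | i < j]|.

(* zig k j y counts the sequences 0 = y_0, ..., y_j = y with y_i + y_{i+1} < k_{i+1}. *)
Fixpoint zig (k : nat -> nat) (j y : nat) : nat :=
  if j is j'.+1 then \sum_(x < k j - y) zig k j' x else y == 0.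

Lemma eq_zig k k' j y : (forall i, i <= j -> k i = k' i) -> zig k j y = zig k' j y.
Proof.
elim: j y => [|j IHj] y //= eqk; rewrite eqk //.
by apply: eq_bigr => x _; apply: IHj => i le_ij; apply: eqk; apply: leqW.
Qed.

Lemma zigS k j y : zig k j.+1 y = \sum_(x < k j.+1 - y) zig k j x.
Proof. by []. Qed.

Arguments zig : simpl never.

Lemma big_subset_setU1 (I : finType) (i0 : I) (A : {set I}) (F : {set I} -> nat) :
  i0 \notin A ->
  \sum_(T : {set I} | T \subset i0 |: A) F T = \sum_(T : {set I} | T \subset A) (F T + F (i0 |: T)).
Proof.
move=> notA; rewrite big_split /= (bigID (fun T : {set I} => i0 \in T)) /= addnC.
congr (_ + _).
  apply: eq_bigl => T; apply/andP/idP => [[sT nT] | sT].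
    apply/subsetP=> i iT; have := subsetP sT i iT; rewrite !inE.
    by case: eqP => // e; rewrite -e iT in nT.
  split; first by rewrite subsetU // sT orbT.
  by apply: contra notA; apply: subsetP.
rewrite (reindex_onto (fun T => i0 |: T) (fun T => T :\ i0)) /=; last first.
  by move=> T /andP[_ iT]; rewrite setD1K.
apply: eq_bigl => T; rewrite setU11 andbT.
apply/andP/idP => [[sT /eqP e] | sT].
  rewrite -e; apply/subsetP=> i; rewrite !inE => /andP[ne]; rewrite (negPf ne) /= => iT.
  have := subsetP sT i; rewrite !inE iT orbT (negPf ne) /=; exact.
split; first exact: setUS.
by rewrite setU1K //; apply: contra notA; apply: subsetP.
Qed.

(** Relates neighbouring values of a zigzag map once the values at odd positions are reversed; the
    condition is then the same at every index. *)
Definition sum_lt m : nat -> rel nat := fun _ y x => y + x < m.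

Lemma sum_shrink m p (F : nat -> nat) : p <= m -> \sum_(v < m | v < p) F v = \sum_(v < p) F v.
Proof. by move=> le_pm; rewrite (big_ord_widen m). Qed.

Lemma exchange_triangle k (F : nat -> nat -> nat) :
  \sum_(x < k) \sum_(i < k - x) F x i = \sum_(i < k) \sum_(x < k - i) F x i.
Proof.
transitivity (\sum_(x < k) \sum_(i < k | x + i < k) F x i).
  apply: eq_bigr => x _; rewrite -(@sum_shrink k _ (F x)) ?leq_subr //.
  by apply: eq_bigl => i; rewrite ltn_subRL.
rewrite (exchange_big_dep predT) //=; apply: eq_bigr => i _.
rewrite -(@sum_shrink k _ (fun x => F x i)) ?leq_subr //.
by apply: eq_bigl => x; rewrite ltn_subRL addnC.
Qed.

(* The binomials count the ways of embedding k levels into m ones so that the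
   level with y levels above it is sent to the one with Y levels above it. *)
Definition embed_weight m n (T : {set 'I_n}) j Y : nat :=
  \sum_(y < count_below T j.+1)
     zig (count_below T) j y * ('C(Y, y) * 'C(m - Y.+1, count_below T j.+1 - y.+1)).

(** For each x, [sum_bin_position] with p = m - Y and q = Y puts i levels among Y values and the
    others among the remaining m - Y; exchanging the triangular sums over x and i leaves the
    recursion [zigS]. *)
Lemma sum_embed_weight m n (T : {set 'I_n}) j Y : Y <= m ->
  \sum_(X < m | X + Y < m) embed_weight m T j X
  = \sum_(i < count_below T j.+1)
      zig (count_below T) j.+1 i * ('C(Y, i) * 'C(m - Y, count_below T j.+1 - i)).
Proof.
move=> le_Ym; set k := count_below T; rewrite /embed_weight -/k.
rewrite (exchange_big_dep predT) //=.
transitivity (\sum_(x < k j.+1) \sum_(i < k j.+1 - x)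
   zig k j x * ('C(Y, i) * 'C(m - Y, k j.+1 - i))).
  apply: eq_bigr => -[x lt_xk] _ /=.
  rewrite -!big_distrr /=; congr (_ * _).
  rewrite (eq_bigl (fun X : 'I_m => X < m - Y)) => [|X]; last by rewrite andbT ltn_subRL addnC.
  rewrite (@sum_shrink m (m - Y) (fun X => 'C(X, x) * 'C(m - X.+1, k j.+1 - x.+1))) ?leq_subr //.
  have := sum_bin_position (m - Y) Y x (k j.+1 - x.+1).
  by rewrite subnK // -subSn // subSS subnKC ?(ltnW lt_xk).
rewrite [LHS](@exchange_triangle (k j.+1)
  (fun x i => zig k j x * ('C(Y, i) * 'C(m - Y, k j.+1 - i)))).
by apply: eq_bigr => i _; rewrite zigS big_distrl.
Qed.

Lemma zig_ge k j y : k j.+1 <= y -> zig k j.+1 y = 0.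
Proof. by rewrite zigS -subn_eq0 => /eqP->; rewrite big_ord0. Qed.

Lemma count_belowS n (T : {set 'I_n}) (i : 'I_n) :
  count_below T i.+1 = (i \in T) + count_below T i.
Proof.
rewrite /count_below (cardsD1 i) !inE ltnSn andbT; congr (_ + _).
apply: eq_card => l; rewrite !inE ltnS (leq_eqVlt l) -val_eqE /=.
by case: ltngtP; rewrite ?andbF ?andbT.
Qed.

Lemma count_belowU n (T : {set 'I_n}) (i0 : 'I_n) j : j <= i0 ->
  count_below (i0 |: T) j = count_below T j.
Proof.
move=> le_ji; apply: eq_card => l; rewrite !inE.
by case: eqP => //= ->; rewrite ltnNge le_ji andbF.
Qed.

(** T is the set of indices at which a new value appears. In the induction the next value is an old
    level or a new one, according to whether its index is left out of T or added to it. *)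
Lemma chains_sum_lt m n j Y : j < n -> Y < m ->
  chains m (sum_lt m) j Y
  = \sum_(T : {set 'I_n} | T \subset [set i : 'I_n | i < j.+1]) embed_weight m T j Y.
Proof.
elim: j Y => [|j IHj] Y lt_jn lt_Ym.
  pose i0 := Ordinal lt_jn.
  have -> : [set i : 'I_n | i < 1] = i0 |: set0.
    by apply/setP=> i; rewrite !inE orbF -val_eqE /= ltnS leqn0.
  rewrite big_subset_setU1 ?inE // (eq_bigl (pred1 set0)) => [|T]; last by rewrite subset0.
  (* The first value is always new: the empty T has weight 0, and T = {0} has weight 1. *)
  rewrite big_pred1_eq /embed_weight.
  rewrite (count_belowS set0 i0) (count_belowS _ i0) setU11 inE count_belowU //.
  have -> : count_below (set0 : {set 'I_n}) 0 = 0.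
    by apply/eqP; rewrite cards_eq0; apply/eqP/setP=> i; rewrite !inE.
  by rewrite big_ord0 big_ord1 /= !bin0.
pose i0 := Ordinal lt_jn.
have -> : [set i : 'I_n | i < j.+2] = i0 |: [set i : 'I_n | i < j.+1].
  by apply/setP=> i; rewrite !inE -val_eqE /= (ltnS i j.+1) leq_eqVlt.
rewrite big_subset_setU1 ?inE ?ltnn //=.
rewrite (eq_bigr (fun X : 'I_m =>
  \sum_(T : {set 'I_n} | T \subset [set i : 'I_n | i < j.+1]) embed_weight m T j X)); last first.
  by move=> X _; rewrite IHj // ltnW.
rewrite exchange_big /=; apply: eq_bigr => T sT.
rewrite sum_embed_weight ?(ltnW lt_Ym) //.
have niT : i0 \notin T by apply/negP => /(subsetP sT); rewrite inE ltnn.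
rewrite /embed_weight (count_belowS T i0) (count_belowS (i0 |: T) i0) setU11 (negPf niT).
rewrite add0n add1n count_belowU //=.
set k := count_below T.
rewrite [X in _ = _ + X]big_ord_recr /=.
rewrite (@eq_zig (count_below (i0 |: T)) k j.+1 (k j.+1)); last first.
  by move=> i le_i; rewrite count_belowU.
(* Adding [i0] creates one more term, y = [k j.+1], which vanishes. *)
rewrite zig_ge // mul0n addn0 -big_split /=; apply: eq_bigr => i _.
rewrite (@eq_zig (count_below (i0 |: T)) k j.+1 i); last by move=> l le_l; rewrite count_belowU.
rewrite -mulnDr -mulnDr; congr (_ * (_ * _)).
(* Pascal's rule: Y is one of the chosen levels, or it is not and becomes a new one. *)
rewrite -(subnSK lt_Ym) -(subnSK (ltn_ord i)) subSS binS addnC; congr (_ + _).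
by rewrite subnSK.
Qed.

Lemma sum_chains_sum_lt m n :
  \sum_(X < m) chains m (sum_lt m) n X
  = \sum_(T : {set 'I_n.+1})
      'C(m, #|T|) * \sum_(y < count_below T n.+1) zig (count_below T) n y.
Proof.
rewrite (eq_bigr (fun X : 'I_m => \sum_(T : {set 'I_n.+1}) embed_weight m T n X)); last first.
  move=> X _; rewrite (@chains_sum_lt m n.+1) //; apply: eq_bigl => T.
  by apply/subsetP=> i _; rewrite inE ltn_ord.
rewrite exchange_big; apply: eq_bigr => T _ /=.
(* Summing over the last value is one more transition, to Y = 0, where ['C(0, i)] keeps only i =
   0. *)
rewrite (eq_bigl (fun X : 'I_m => X + 0 < m)) => [|X]; last by rewrite addn0 ltn_ord.
have -> : #|T| = count_below T n.+1.
  by apply: eq_card => i; rewrite inE ltn_ord andbT.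
rewrite sum_embed_weight // subn0 mulnC; set k := count_below T.
case E: (k n.+1) => [|p]; first by rewrite !big_ord0.
rewrite big_ord_recl big1 => [|i _]; last by rewrite bin0n mul0n muln0.
by rewrite zigS bin0 E !subn0 mul1n addn0.
Qed.

(** * Alternating permutations and zigzag maps *)

Lemma card_ord_lt n k : k <= n -> #|[set i : 'I_n | i < k]| = k.
Proof.
move=> le_kn; rewrite -sum1dep_card -(big_ord_widen n (fun=> 1) le_kn).
by rewrite sum1_card card_ord.
Qed.

Definition sorts n (w : 'S_n) (K : 'I_n -> nat) : bool :=
  [forall i, forall j, (w i < w j) == (K i < K j)].

Lemma sortsP n (w : 'S_n) (K : 'I_n -> nat) :
  reflect (forall i j, (w i < w j) = (K i < K j)) (sorts w K).
Proof.
apply: (iffP forallP) => [h i j | h i]; first by have /forallP/(_ j)/eqP := h i.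
by apply/forallP=> j; rewrite h.
Qed.

(** The sorting permutation sends i to its rank, the size of [lower i]. It is unique because w i is
    the number of values below w i, counted through w. *)
Lemma sum_sorts n (K : 'I_n -> nat) : injective K -> \sum_(w : 'S_n) sorts w K = 1.
Proof.
move=> injK; pose lower i := [set j | K j < K i].
have lower_lt i : #|lower i| < n.
  rewrite -[n in leqRHS]card_ord -cardsT; apply: proper_card.
  by rewrite properT; apply/eqP=> /setP/(_ i); rewrite !inE ltnn.
have rank_mono i j : (#|lower i| < #|lower j|) = (K i < K j).
  have homo a b : K a < K b -> #|lower a| < #|lower b|.
    move=> lt_ab; apply: proper_card; apply/properP; split.
      by apply/subsetP=> l; rewrite !inE => /ltn_trans->.
    by exists a; rewrite !inE ?lt_ab ?ltnn.
  case: (ltngtP (K i) (K j)) => [/homo -> // | /homo h | /injK ->]; last by rewrite ltnn.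
  by rewrite ltnNge ltnW.
have rank_inj : injective (fun i => Ordinal (lower_lt i)).
  move=> i j /(congr1 val)/= e; apply: injK.
  by case: (ltngtP (K i) (K j)) => //; rewrite -rank_mono e ltnn.
rewrite (bigD1 (perm rank_inj)) //= big1 => [|w ne_w].
  by rewrite (_ : sorts _ _) //; apply/sortsP=> i j; rewrite !permE rank_mono.
case: sortsP => // sort_w; case/eqP: ne_w; apply/permP=> i; apply: val_inj.
rewrite permE /= -[LHS](@card_ord_lt n) ?(ltnW (ltn_ord _)) //.
rewrite -(card_preimset _ (@perm_inj _ w)); apply: eq_card => j.
by rewrite !inE sort_w.
Qed.

Lemma adjacent_ltn N (K : 'I_N.+1 -> nat) :
  reflect (forall p q : 'I_N.+1, (p < q) = (K p < K q))
    [forall i : 'I_N, K (widen_ord (leqnSn N) i) < K (lift ord0 i)].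
Proof.
apply: (iffP forallP) => [step p q | mono i]; last by rewrite -mono /= /bump.
have homo : {in [pred i | i <= N] &, {homo (fun i => K (inord i)) : i j / i < j >-> i < j}}.
  apply: homo_ltn_in => [? ? ?|i j _ le_jN k /andP[_ lt_kj]|i]; first exact: ltn_trans.
    exact: leq_trans (ltnW lt_kj) le_jN.
  rewrite !inE => _ lt_iN; have := step (Ordinal lt_iN).
  by congr (K _ < K _); apply: val_inj; rewrite /= inordK // ltnW.
have homoK (a b : 'I_N.+1) : a < b -> K a < K b.
  by move=> lt_ab; have := homo a b (leq_ord a) (leq_ord b) lt_ab; rewrite !inord_val.
case: (ltngtP p q) => [/homoK -> // | /homoK h | /val_inj ->]; last by rewrite ltnn.
by rewrite ltnNge ltnW.
Qed.

(* The natural labelling 0 < 2 < 1 < 4 < 3 < ... of the zigzag poset: adjacent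
   positions are labelled in the order in which an alternating permutation
   requires them, and other positions from left to right. *)
Definition label (i : nat) : nat := if odd i then i.+1 else i.-1.

Lemma label_inj : injective label.
Proof.
move=> i j; rewrite /label.
have := odd_double_half i; have := odd_double_half j.
by case: (odd i); case: (odd j) => /=; lia.
Qed.

(** [label] exchanges each odd position with the next one. The hypotheses, which alternation will
    provide, exclude exactly the adjacent pairs at which the two sides differ. *)
Lemma ltn_label a b : (b == a.+1 -> ~~ odd a) -> (a == b.+1 -> odd b) ->
  (label b < label a) = (b.+1 < a).
Proof.
rewrite /label.
have := odd_double_half a; have := odd_double_half b.
by case: (odd a); case: (odd b) => /=; lia.
Qed.

(** The lexicographic order on pairs (f i, label i), in one number; a label can be as large as N+1,
    hence the base [N.+2]. *)
Definition key N m (f : {ffun 'I_N.+1 -> 'I_m}) (i : 'I_N.+1) : nat := f i * N.+2 + label i.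

Lemma label_le N (i : 'I_N.+1) : label i < N.+2.
Proof. by move: (ltn_ord i); rewrite /label; case: odd; lia. Qed.

Lemma ltn_lex N a b x y : x < N -> y < N ->
  (a * N + x < b * N + y) = (if x < y then a <= b else a < b).
Proof. by move=> lt_x lt_y; case: (ltnP x y) => xy; nia. Qed.

Lemma ltn_key N m (f : {ffun 'I_N.+1 -> 'I_m}) i j :
  (key f i < key f j) = (if label i < label j then f i <= f j else f i < f j).
Proof. by rewrite ltn_lex ?label_le. Qed.

Lemma key_inj N m (f : {ffun 'I_N.+1 -> 'I_m}) : injective (key f).
Proof.
move=> i j eq_ij; apply/val_inj/label_inj.
have := ltn_key f i j; have := ltn_key f j i; rewrite eq_ij ltnn.
by case: (ltngtP (label i) (label j)) => // _; case: (ltngtP (f i) (f j)).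
Qed.

Definition zigzag N m (f : {ffun 'I_N.+1 -> 'I_m}) : bool :=
  [forall i : 'I_N.+1, forall j : 'I_N.+1,
     (j == i.+1 :> nat) ==> if odd i then f j <= f i else f i <= f j].

(** Between neighbours the label breaks ties of f in the direction that alternation requires, so a
    weak inequality for f is a strict one for w. *)
Lemma zigzag_sorts N m (f : {ffun 'I_N.+1 -> 'I_m}) (w : 'S_N.+1) :
  sorts w (key f) -> zigzag f = (w \in Alt N.+1).
Proof.
move=> /sortsP sort_w; rewrite inE; apply: eq_forallb => i; apply: eq_forallb => j.
case: eqP => //= eq_j; rewrite !sort_w !ltn_key /label eq_j /=.
by case: (odd i) => /=; rewrite ?ltnSn ?leqnn // ifT //; lia.
Qed.

Lemma card_zigzag N m :
  #|[set f : {ffun 'I_N.+1 -> 'I_m} | zigzag f]| = \sum_(X < m) chains m (sum_lt m) N X.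
Proof.
rewrite -card_chains.
pose flip (f : {ffun 'I_N.+1 -> 'I_m}) :=
  [ffun i : 'I_N.+1 => if odd i then rev_ord (f i) else f i].
have flipK : involutive flip.
  by move=> f; apply/ffunP=> i; rewrite !ffunE; case: odd; rewrite ?rev_ordK.
rewrite -(card_preimset _ (can_inj flipK)); apply: eq_card => f; rewrite !inE.
apply/forallP/forallP=> [zz i | ch i].
  have /forallP/(_ (lift ord0 i))/implyP := zz (widen_ord (leqnSn N) i).
  rewrite /sum_lt !ffunE /= /bump add1n eqxx /= => /(_ isT).
  move: (ltn_ord (f (widen_ord (leqnSn N) i))) (ltn_ord (f (lift ord0 i))).
  by case: (odd i) => /=; lia.
apply/forallP=> j; apply/implyP=> /eqP eq_j.
have lt_iN : i < N by rewrite -ltnS -eq_j.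
have := ch (Ordinal lt_iN); rewrite /sum_lt.
have -> : widen_ord (leqnSn N) (Ordinal lt_iN) = i by apply: val_inj.
have -> : lift ord0 (Ordinal lt_iN) = j by apply: val_inj; rewrite /= eq_j.
rewrite !ffunE eq_j /=; move: (ltn_ord (f i)) (ltn_ord (f j)).
by case: (odd i) => /=; lia.
Qed.

Definition label_descent N (w : 'S_N.+1) (p : nat) : bool :=
  label (w^-1%g (inord p.+1)) < label (w^-1%g (inord p)).

(** Read in the order of w, f must increase weakly, and strictly at label descents; [chains_sorted]
    and a sum over the last value then give one binomial. *)
Lemma card_sorts_key N m (w : 'S_N.+1) :
  \sum_(f : {ffun 'I_N.+1 -> 'I_m}) sorts w (key f)
  = 'C(m + \sum_(p < N) ~~ label_descent w p, N.+1).
Proof.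
pose r p (y x : nat) := if label_descent w p then y < x else y <= x.
transitivity (\sum_(x < m) chains m r N x); last first.
  rewrite (eq_bigr (fun x : 'I_m => 'C(x + \sum_(p < N) ~~ label_descent w p, N))).
    rewrite sum_bin_shift // -[N in leqRHS]card_ord -sum1_card.
    by apply: leq_sum => p _; exact: leq_b1.
  by move=> x _; exact: chains_sorted.
rewrite -card_chains -sum1dep_card [RHS]big_mkcond /=.
rewrite (reindex (fun c : {ffun 'I_N.+1 -> 'I_m} => [ffun i => c (w i)])) /=; last first.
  exists (fun f : {ffun 'I_N.+1 -> 'I_m} => [ffun p => f (w^-1%g p)]) => f _;
  by apply/ffunP=> i; rewrite !ffunE ?permK ?permKV.
apply: eq_bigr => c _; rewrite -[RHS]/(nat_of_bool _).
set f := [ffun _ => _].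
have -> : is_chain r c =
    [forall p : 'I_N, key f (w^-1%g (widen_ord (leqnSn N) p)) < key f (w^-1%g (lift ord0 p))].
  apply: eq_forallb => p; rewrite ltn_key !ffunE !permKV /r /label_descent.
  have -> : inord p.+1 = lift ord0 p by apply: val_inj; rewrite /= inordK ?ltnS.
  have -> : inord p = widen_ord (leqnSn N) p by apply: val_inj; rewrite /= inordK // ltnS ltnW.
  case: ltngtP => // /label_inj/val_inj/perm_inj/(congr1 val) /=.
  by rewrite /bump; lia.
congr (nat_of_bool _); apply/sortsP/(adjacent_ltn (fun p => key f (w^-1%g p))) => [h p q | h i j].
  by rewrite -h !permKV.
by have := h (w i) (w j); rewrite !permK.
Qed.

(** Consecutive values in adjacent positions stand in the order that alternation dictates, which
    gives the hypotheses of [ltn_label]. *)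
Lemma des1_label N (w : 'S_N.+1) : w \in Alt N.+1 ->
  des1 w^-1%g = \sum_(p < N) label_descent w p.
Proof.
rewrite inE => /forallP altw; rewrite /des1 -sum1dep_card big_mkcond big_ord_recr /=.
(* The last index has no successor and contributes 0. *)
rewrite [X in _ + X]ifF ?addn0; last first.
  by apply/negbTE/existsP=> -[j /andP[/eqP ej _]]; have := ltn_ord j; rewrite ej ltnn.
apply: eq_bigr => p _; rewrite /label_descent.
have -> : inord p.+1 = lift ord0 p by apply: val_inj; rewrite /= inordK ?ltnS.
have -> : inord p = widen_ord (leqnSn N) p by apply: val_inj; rewrite /= inordK // ltnS ltnW.
set i := widen_ord _ p; set j := lift ord0 p.
have lt_ij : i < j by rewrite /= /bump.
rewrite ltn_label.
- rewrite -[RHS]/(nat_of_bool _); case: existsP => [[j' /andP[/eqP ej']] | ne].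
    by rewrite (_ : j' = j) => [->|] //; apply: val_inj; rewrite /= ej'.
  apply/esym/eqP; rewrite eqb0; apply/negP=> lt_v; case: ne; exists j.
  by rewrite lt_v /= /bump add1n eqxx.
- move=> adj; have /forallP/(_ (w^-1%g j))/implyP/(_ adj) := altw (w^-1%g i).
  by rewrite !permKV; case: odd => //; rewrite ltnNge ltnW.
- move=> adj; have /forallP/(_ (w^-1%g i))/implyP/(_ adj) := altw (w^-1%g j).
  by rewrite !permKV; case: odd => //; rewrite ltnNge ltnW.
Qed.

(** Pairs (f, w) with w sorting [key f] are counted twice: each f has one w, and the number of f for
    a given w is [card_sorts_key], whose label ascents number N - [des1 w^-1]. *)
Lemma sum_Alt_bin N m :
  \sum_(w in Alt N.+1) 'C(m + N.+1 - (des1 w^-1%g).+1, N.+1)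
  = \sum_(X < m) chains m (sum_lt m) N X.
Proof.
rewrite -card_zigzag -sum1dep_card.
transitivity (\sum_(f : {ffun 'I_N.+1 -> 'I_m} | zigzag f)
  \sum_(w : 'S_N.+1) sorts w (key f)); last first.
  by apply: eq_bigr => f _; rewrite sum_sorts //; exact: key_inj.
rewrite exchange_big big_mkcond; apply: eq_bigr => w _ /=.
transitivity (\sum_(f : {ffun 'I_N.+1 -> 'I_m})
  if w \in Alt N.+1 then sorts w (key f) : nat else 0).
  case: ifP => altw; last by rewrite big1.
  rewrite card_sorts_key des1_label //; congr 'C(_, _).
  have : \sum_(p < N) label_descent w p + \sum_(p < N) ~~ label_descent w p = N.
    rewrite -big_split /= (eq_bigr (fun=> 1)) ?sum1_card ?card_ord // => p _.
    by case: label_descent.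
  lia.
rewrite [RHS]big_mkcond; apply: eq_bigr => f _.
case sort_w: (sorts w (key f)); last by rewrite !if_same.
by rewrite (zigzag_sorts sort_w).
Qed.

(** * Parking functions *)

Import GRing.Theory.
Local Open Scope ring_scope.

(** Induction on p + a. At a = 0 trinomial revision leaves the expansion of (1 - 1)^p; for positive
    p and a, Pascal's rule on both sides leads to (p-1, a) and (p, a-1). *)
Lemma sum_bin_alternating (y p a : nat) :
  \sum_(e < p.+1) (-1) ^+ e * ('C(p + y + a, e + y + a) * 'C(y + e, e))%:R
  = ('C((p + a).-1, p))%:R :> int.
Proof.
have [s le_s] := ubnP (p + a); elim: s => // s IHs in p a le_s *.
case: p => [|p] in le_s *; first by rewrite big_ord1 /= !add0n addn0 binn !bin0 mul1r.
case: a => [|a] in le_s *.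
  rewrite !addn0 bin_small //.
  have := exprDn (1 : int) (-1) p.+1; rewrite subrr expr0n /= => E.
  transitivity (('C(p.+1 + y, y))%:R * (0 : int)); last by rewrite mulr0.
  rewrite [X in _ * X]E big_distrr /=.
  apply: eq_bigr => -[e le_e] _ /=.
  by rewrite expr1n mul1r addn0 bin_trinomial // -[_ ^+ _ *+ _]mulr_natr natrM mulrCA.
have -> : 'C((p.+1 + a.+1).-1, p.+1) = ('C((p + a.+1).-1, p) + 'C((p.+1 + a).-1, p.+1))%N.
  by rewrite !addSn !addnS /= binS addnC.
rewrite natrD -!IHs; [|lia..].
rewrite big_ord_recr [X in _ = _ + X]big_ord_recr /= addrA -big_split /=.
congr (_ + _); last by rewrite -!addSnnS !binn.
by apply: eq_bigr => e _; rewrite -mulrDr -natrD -mulnDl !addnS !addSn binS.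
Qed.

(** The system is triangular: for m <= n the binomial is 0 at d > m and 1 at d = m, so m = 0, ..., n
    determine the coefficients in turn. *)
Lemma poly_eq_bin n (p q : {poly int}) : (size p <= n.+1)%N -> (size q <= n.+1)%N ->
  (forall m, \sum_(d < n.+1) p`_d * ('C(m + n - d, n))%:R
           = \sum_(d < n.+1) q`_d * ('C(m + n - d, n))%:R) -> p = q.
Proof.
move=> sz_p sz_q eq_pq; apply/polyP=> m.
have [lt_nm | le_mn] := ltnP n m.
  by rewrite !nth_default // (leq_trans _ lt_nm).
have [s lt_ms] := ubnP m; elim: s => // s IHs in m le_mn lt_ms *.
have lt_mn1 : (m < n.+1)%N by [].
pose i0 := Ordinal lt_mn1.
have E : \sum_(i < n.+1 | i != i0) q`_i * ('C(m + n - i, n))%:R =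
         \sum_(i < n.+1 | i != i0) p`_i * ('C(m + n - i, n))%:R.
  apply: eq_bigr => i; rewrite -val_eqE /= => ne_im.
  have [lt_im | le_mi] := ltnP i m.
    by rewrite (IHs i) //; lia.
  rewrite bin_small ?mulr0 //; move: (ltn_ord i) ne_im; lia.
move: (eq_pq m); rewrite (bigD1 i0) //= [in RHS](bigD1 i0) //= E.
rewrite addKn binn !mulr1; exact: addIr.
Qed.

Lemma sum_coef_bin (I : finType) (P : pred I) (c : I -> int) (d : I -> nat) n m :
  (forall i, P i -> (d i <= n)%N) ->
  \sum_(k < n.+1) (\sum_(i | P i) c i *: 'X^(d i))`_k * ('C(m + n - k, n))%:R
  = \sum_(i | P i) c i * ('C(m + n - d i, n))%:R.
Proof.
move=> le_dn.
under eq_bigr => k _ do rewrite coef_sum big_distrl /=.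
rewrite exchange_big /=; apply: eq_bigr => i Pi.
have lt_dn : (d i < n.+1)%N by rewrite ltnS le_dn.
rewrite (bigD1 (Ordinal lt_dn)) //= big1 => [|k].
  by rewrite coefZ coefXn eqxx mulr1 addr0.
by rewrite -val_eqE /= coefZ coefXn => /negPf->; rewrite mulr0 mul0r.
Qed.

Lemma size_sum_monomials (I : finType) (P : pred I) (c : I -> int) (d : I -> nat) n :
  (forall i, P i -> (d i <= n)%N) -> (size (\sum_(i | P i) c i *: 'X^(d i))%R <= n.+1)%N.
Proof.
move=> le_dn; apply: (leq_trans (size_sum _ _ _)); apply/bigmax_leqP => i Pi.
by rewrite (leq_trans (size_scale_leq _ _)) // size_polyXn ltnS le_dn.
Qed.

(** * Level sets and signed sums over chains of sets *)

(** The value 0 belongs to no level, so it can mark an entry not yet assigned. *)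
Definition level (I : finType) N (f : {ffun I -> 'I_N.+1}) (l : nat) : {set I} :=
  [set i | (0 < f i <= l)%N].

(** The sum, over chains of sets from S_0 = [set0] up to S_j = R, of the product of [w l S_l] for 1
    <= l <= j. *)
Fixpoint chain_sum (I : finType) (w : nat -> {set I} -> int) j (R : {set I}) : int :=
  if j is j'.+1 then w j R * \sum_(S : {set I} | S \subset R) chain_sum w j' S
  else (R == set0)%:R.

Lemma chain_sumS (I : finType) (w : nat -> {set I} -> int) j (R : {set I}) :
  chain_sum w j.+1 R = w j.+1 R * \sum_(S : {set I} | S \subset R) chain_sum w j S.
Proof. by []. Qed.

Lemma levelS_sub (I : finType) N (f : {ffun I -> 'I_N.+1}) l : level f l \subset level f l.+1.
Proof. by apply/subsetP=> i; rewrite !inE => /andP[-> /leqW]. Qed.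

(** A map is determined by its chain of level sets; the induction removes the largest value. *)
Lemma sum_levels (I : finType) N (w : nat -> {set I} -> int) j (R : {set I}) : (j <= N)%N ->
  \sum_(f : {ffun I -> 'I_N.+1} | [forall i, f i <= j]%N && (level f j == R))
     \prod_(l < j) w l.+1 (level f l.+1)
  = chain_sum w j R.
Proof.
elim: j R => [|j IHj] R le_jN /=.
  have lev0 (f : {ffun I -> 'I_N.+1}) : level f 0 = set0.
    by apply/setP=> i; rewrite !inE; case: (f i) => -[].
  under eq_bigr => f _ do rewrite big_ord0.
  case: eqP => [->|ne_R]; last first.
    by rewrite big_pred0 // => f; rewrite lev0 eq_sym; apply/andP=> -[_ /eqP].
  rewrite (big_pred1 [ffun=> ord0]) // => f; rewrite lev0 eqxx andbT.
  apply/forallP/eqP => [f0 | -> i]; last by rewrite ffunE.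
  by apply/ffunP=> i; rewrite ffunE; apply/val_inj/eqP; rewrite -leqn0 f0.
rewrite (eq_bigr (fun f => w j.+1 R * \prod_(l < j) w l.+1 (level f l.+1))); last first.
  by move=> f /andP[_ /eqP defR]; rewrite big_ord_recr /= defR mulrC.
rewrite -big_distrr /=; congr (_ * _).
rewrite (partition_big (fun f => level f j) (fun S => S \subset R)) /=; last first.
  by move=> f /andP[_ /eqP <-]; exact: levelS_sub.
apply: eq_bigr => S sSR; rewrite -IHj ?(ltnW le_jN) //.
(* [h] gives the value j+1 to the elements that R has beyond S, and [h'] resets them to 0. *)
pose h (g : {ffun I -> 'I_N.+1}) := [ffun i => if i \in R :\: S then inord j.+1 else g i].
pose h' (f : {ffun I -> 'I_N.+1}) := [ffun i => if (f i <= j)%N then f i else ord0].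
have valj : (inord j.+1 : 'I_N.+1) = j.+1 :> nat by rewrite inordK.
have lev_h' (f : {ffun I -> 'I_N.+1}) : level (h' f) j = level f j.
  apply/setP=> i; rewrite !inE ffunE.
  by case E: (f i <= j)%N; rewrite ?E ?andbF.
have hK (f : {ffun I -> 'I_N.+1}) :
    [forall i, (f i <= j.+1)%N] -> level f j.+1 = R -> level f j = S -> h (h' f) = f.
  move=> /forallP le_f defR defS; apply/ffunP=> i; rewrite !ffunE -defR -defS !inE.
  case: (posnP (f i)) => [f0|f_gt0] /=; first by rewrite f0; apply: val_inj.
  rewrite le_f; case E: (f i <= j)%N; rewrite ?E //=; apply: val_inj.
  have lt_jf : (j < f i)%N by rewrite ltnNge E.
  rewrite /= valj.
  by apply/eqP; rewrite eqn_leq lt_jf le_f.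
rewrite (reindex_onto h h') /=; last first.
  by move=> f /andP[/andP[le_f /eqP defR] /eqP defS]; exact: hK.
have lev_h (g : {ffun I -> 'I_N.+1}) l : (l <= j)%N -> level g j = S -> level (h g) l = level g l.
  move=> le_lj defS; apply/setP=> i; rewrite !inE ffunE !inE -defS !inE.
  case: ifP => // /andP[nlev _]; rewrite valj [(j < l)%N]ltnNge le_lj /=.
  by apply/esym/negbTE; apply: contra nlev => /andP[-> /leq_trans->].
apply: eq_big => [g | g /andP[/andP[_ /eqP defS] /eqP defg]]; last first.
  have gS : level g j = S by rewrite -defg lev_h'.
  by apply: eq_bigr => l _; rewrite lev_h.
apply/andP/andP => [[/andP[_ /eqP defS] /eqP defg] | [/forallP le_g /eqP defS]].
  split; last by rewrite -defg lev_h' defS.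
  by apply/forallP=> i; rewrite -defg ffunE; case: ifP.
split; last first.
  apply/eqP/ffunP=> i; rewrite !ffunE.
  case: (boolP (i \in R :\: S)) => [|_]; last by rewrite le_g.
  rewrite inE -defS inE => /andP[nlev _]; rewrite valj ltnn.
  apply/val_inj/esym/eqP; rewrite /= -leqn0 leqNgt.
  by apply: contra nlev => ->; rewrite le_g.
rewrite (lev_h g j) // defS eqxx andbT; apply/andP; split. 
  by apply/forallP=> i; rewrite ffunE; case: ifP; rewrite ?valj // leqW.
apply/eqP/setP=> i; rewrite inE ffunE inE.
have [iS | niS] /= := boolP (i \in S).
  by rewrite (subsetP sSR) //; move: iS; rewrite -defS inE => /andP[-> /leqW].
case: ifP => [_|niR]; first by rewrite valj leqnn.
by apply: contraNF niS => /andP[gi _]; rewrite -defS inE gi le_g.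
Qed.

Lemma sum_interval_card (I : finType) (C R : {set I}) (F : nat -> int) : C \subset R ->
  \sum_(S : {set I} | (S \subset R) && (C \subset S)) F #|S|
  = \sum_(d < (#|R| - #|C|).+1) ('C(#|R| - #|C|, d))%:R * F (#|C| + d)%N.
Proof.
move=> sCR; rewrite (reindex_onto (fun D => C :|: D) (fun S => S :\: C)) /=; last first.
  by move=> S /andP[_ sCS]; rewrite setDE setUIr setUCr setIT; apply/setUidPr.
rewrite (eq_bigl (fun D : {set I} => D \subset R :\: C)) => [|D]; last first.
  rewrite subUset sCR subsetUl andbT setDUl setDv set0U subsetD.
  by rewrite /= (sameP eqP setDidPl).
rewrite -cardsDS //.
rewrite (partition_big (fun D : {set I} => inord #|D| : 'I_#|R :\: C|.+1) predT) //=.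
apply: eq_bigr => d _.
rewrite (eq_bigr (fun=> F (#|C| + d)%N)) => [|D /andP[sD /eqP <-]]; last first.
  rewrite inordK ?ltnS ?subset_leq_card // cardsU.
  rewrite (_ : C :&: D = set0) ?cards0 ?subn0 //.
  by apply/disjoint_setI0; move: sD; rewrite subsetD disjoint_sym => /andP[].
rewrite sumr_const -cards_draws [RHS]mulrC mulr_natr; congr (_ *+ _).
rewrite -[RHS]cardsE; apply: eq_card => D; rewrite !inE unfold_in /=; apply: andb_id2l => sD.
by rewrite -val_eqE /= inordK // ltnS subset_leq_card.
Qed.

(* A parking function p has excedances p \subset T iff every position outside
   T carries a value at most its index; in terms of the level sets this reads
   capped T l \subset level p l for all l. *)
Definition capped n (T : {set 'I_n}) (l : nat) : {set 'I_n} := [set i | (i \notin T) && (i < l)%N].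

(** The size bound is the parking condition at l, the inclusion keeps excedances in T, and the
    exponents add up to [cosum]. *)
Definition cap_weight n (T : {set 'I_n}) (l : nat) (R : {set 'I_n}) : int :=
  if (l <= #|R|)%N && (capped T l \subset R) then (-1) ^+ (#|R| - l) else 0.

Lemma card_capped n (T : {set 'I_n}) l : (l <= n)%N -> (#|capped T l| + count_below T l = l)%N.
Proof.
move=> le_ln; have := cardsID T [set i : 'I_n | (i < l)%N].
rewrite card_ord_lt //.
move=> cardE; rewrite -[RHS]cardE addnC; congr (_ + _)%N; apply: eq_card => i; rewrite !inE //.
by rewrite andbC.
Qed.

Lemma count_below_homo n (T : {set 'I_n}) : {homo count_below T : i j / (i <= j)%N}.
Proof.
move=> i j le_ij; apply: subset_leq_card; apply/subsetP=> l; rewrite !inE.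
by move=> /andP[-> /leq_trans->].
Qed.

(** The range goes up to [k j.+1] included, so that for j = 0 the term y = 0 is present even if
    [k 1] is 0. *)
Definition zig_moment (k : nat -> nat) j e : nat :=
  \sum_(y < (k j.+1).+1) zig k j y * 'C(y + e, e).

(** [sum_bin_alternating] removes d, [sum_bin_shift] expands the resulting binomial as a sum over x
    < p - y, and exchanging x and y produces [zigS]. *)
Lemma zig_momentS (k : nat -> nat) j e : (k j.+1 <= k j.+2)%N ->
  \sum_(d < e.+2) ('C(e + (k j.+1).+1, k j.+1 + d))%:R * ((-1) ^+ d * (zig_moment k j d)%:R)
  = (zig_moment k j.+1 e)%:R :> int.
Proof.
move=> le_k; set p := k j.+1.
transitivity (\sum_(y < p.+1) (zig k j y)%:R * ('C((e.+1 + (p - y)).-1, e.+1))%:R : int).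
  rewrite /zig_moment -/p.
  under eq_bigr => d _ do rewrite mulrA natr_sum big_distrr /=.
  rewrite exchange_big /=; apply: eq_bigr => y _.
  rewrite -(sum_bin_alternating y e.+1 (p - y)) big_distrr /=; apply: eq_bigr => d _.
  have le_yp : (y <= p)%N by rewrite -ltnS.
  rewrite -!addnA subnKC // addSnnS (addnC p) !natrM; ring.
under eq_bigr => y _ do rewrite addSn /= -natrM addnC -(sum_bin_shift _ (leqnn e)).
rewrite -natr_sum; congr (_%:R).
rewrite big_ord_recr /= subnn big_ord0 muln0 addn0.
under eq_bigr => y _ do rewrite big_distrr /=.
rewrite (@exchange_triangle p (fun y x => zig k j y * 'C(x + e, e))%N) /zig_moment.
transitivity (\sum_(x < p) zig k j.+1 x * 'C(x + e, e))%N.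
  by apply: eq_bigr => x _; rewrite zigS big_distrl.
have le_pk : (p <= (k j.+2).+1)%N by rewrite leqW.
rewrite (big_ord_widen _ (fun x => zig k j.+1 x * 'C(x + e, e))%N le_pk) big_mkcond.
by apply: eq_bigr => x _; case: ltnP => // le_px; rewrite zig_ge.
Qed.

(** Beyond the weight of R, only the excess of its size over j+1 matters: the sets S below R are
    grouped by size, and [zig_momentS] sums them. *)
Lemma chain_sum_cap n (T : {set 'I_n}) j R : (j < n)%N ->
  chain_sum (cap_weight T) j.+1 R
  = cap_weight T j.+1 R * (zig_moment (count_below T) j (#|R| - j.+1))%:R.
Proof.
elim: j R => [|j IHj] R lt_jn.
  congr (_ * _).
  rewrite (eq_bigr (fun S : {set 'I_n} => if S == set0 then 1 else 0)); last first.
    by move=> S _; rewrite /=; case: eqP.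
  rewrite -big_mkcondr (big_pred1 set0) => [|S]; last first.
    by rewrite andb_idl //= => /eqP->; rewrite sub0set.
  rewrite /zig_moment big_ord_recl big1 => [|i _]; last by rewrite /zig mul0n.
  by rewrite /zig /= add0n binn.
rewrite chain_sumS.
rewrite [cap_weight T j.+2 R]/cap_weight; case: ifP => [/andP[le_jR sCR]|_]; last by rewrite !mul0r.
congr (_ * _).
have le_jn := ltnW lt_jn.
pose k := count_below T.
pose F s := if (j < s)%N then (-1) ^+ (s - j.+1) * (zig_moment k j (s - j.+1))%:R else 0 : int.
rewrite (eq_bigr (fun S : {set 'I_n} => if capped T j.+1 \subset S then F #|S| else 0)); last first.
  move=> S _; rewrite IHj // /cap_weight /F; case: (_ \subset S); last by rewrite andbF mul0r.
  by rewrite andbT; case: ifP; rewrite ?mul0r.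
rewrite -big_mkcondr sum_interval_card; last first.
  apply: subset_trans sCR; apply/subsetP=> i; rewrite !inE => /andP[-> /=].
  exact: leqW.
have cK := card_capped T le_jn.
set e := (#|R| - j.+2)%N.
have -> : (#|R| - #|capped T j.+1| = e + (k j.+1).+1)%N by rewrite /e; move: cK; rewrite -/k; lia.
have -> : ((e + (k j.+1).+1).+1 = k j.+1 + e.+2)%N by lia.
(* For d < [k j.+1] the set S has at most j elements and contributes 0; the later sizes have excess
   0, 1, ..., e+1. *)
rewrite big_split_ord /= big1 ?add0r => [|d _]; last first.
  rewrite /F ifF ?mulr0 //; apply/negbTE; rewrite -leqNgt -ltnS.
  by rewrite -[X in (_ < X)%N]cK ltn_add2l /= ltn_ord.
rewrite -(zig_momentS (k := k)); last exact: count_below_homo.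
apply: eq_bigr => d _; congr (_ * _).
have -> : (#|capped T j.+1| + (k j.+1 + d) = j.+1 + d)%N by move: cK; rewrite -/k; lia.
by rewrite /F ltn_addr ?addKn.
Qed.

(** Length at least 2 matters here: at length 1 with T empty the chain sum is 1, while the sum over
    y is empty. *)
Lemma chain_sum_setT n (T : {set 'I_n.+2}) :
  chain_sum (cap_weight T) n.+2 setT
  = (\sum_(y < count_below T n.+2) zig (count_below T) n.+1 y)%:R.
Proof.
rewrite chain_sum_cap // /cap_weight cardsT card_ord leqnn subsetT subnn mul1r.
congr (_%:R); rewrite /zig_moment big_ord_recr /= zig_ge ?count_below_homo // mul0n addn0.
by apply: eq_bigr => y _; rewrite addn0 bin0 muln1.
Qed.

(** * Parking functions read through their level sets *)

Lemma nth_sort_leq (s : seq nat) j v : (j < size s)%N ->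
  (nth 0 (sort leq s) j <= v)%N = (j < count (fun x => x <= v) s)%N.
Proof.
move=> lt_js; rewrite -(seq.permP (permEl (perm_sort leq s))).
have lt_js' : (j < size (sort leq s))%N by rewrite size_sort.
have homo_s := sorted_leq_nth leq_trans leqnn 0%N (sort_sorted leq_total s).
move: (sort leq s) lt_js' homo_s => t lt_jt homo_t; apply/idP/idP => [le_v | ].
  rewrite -(cat_take_drop j.+1 t) count_cat ltn_addr //.
  suff /[!all_count]/eqP-> : all (fun x => x <= v)%N (take j.+1 t) by rewrite size_takel.
  apply/(all_nthP 0%N) => i; rewrite size_takel // => lt_ij.
  rewrite nth_take //; apply: leq_trans le_v; apply: homo_t => //.
  by rewrite inE (leq_trans lt_ij).
apply: contraTT; rewrite -leqNgt -ltnNge => lt_v.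
rewrite -(cat_take_drop j t) count_cat [X in (_ + X)%N](_ : _ = 0%N).
  by rewrite addn0 (leq_trans (count_size _ _)) // size_takel // ltnW.
apply/eqP; rewrite -leqn0 leqNgt -has_count -all_predC; apply/(all_nthP 0%N) => i.
rewrite size_drop ltn_subRL => lt_i; rewrite nth_drop /= -ltnNge (leq_trans lt_v) //.
by apply: homo_t; rewrite ?leq_addr.
Qed.

Lemma sum_leq_succ n c : (0 < c <= n.+1)%N -> (\sum_(l < n) (c <= l.+1) + c = n.+1)%N.
Proof.
elim: n => [|n IHn]; first by rewrite big_ord0; case: c => [|[]].
move=> /andP[c_gt0]; rewrite leq_eqVlt => /orP[/eqP-> | lt_cn].
  by rewrite big1 // => l _; rewrite leqNgt ltnS ltn_ord.
by rewrite big_ord_recr /= -ltnS lt_cn addnAC IHn ?c_gt0 // addn1.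
Qed.

Definition tuple_ffun n (T : Type) (p : n.-tuple T) : {ffun 'I_n -> T} := [ffun i => tnth p i].

(** The sorted entry of index l is at most l+1 exactly when more than l entries are; the full level
    n says that all entries are positive. *)
Lemma parking_level n (p : n.-tuple 'I_n.+1) :
  parking [seq val x | x <- p]
  = (level (tuple_ffun p) n == setT)
    && [forall l : 'I_n, (l < #|level (tuple_ffun p) l.+1|)%N].
Proof.
rewrite /parking.
have -> : all (fun x => 0 < x)%N [seq val x | x <- p] = (level (tuple_ffun p) n == setT).
  rewrite all_map; apply/all_tnthP/eqP=> [/= p_gt0 | lev i].
    by apply/setP=> i; rewrite !inE ffunE p_gt0 -ltnS ltn_ord.
  by have := in_setT i; rewrite -lev inE ffunE => /andP[].
apply: andb_id2l => /eqP lev.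
have p_gt0 i : (0 < tnth p i)%N by have := in_setT i; rewrite -lev inE ffunE => /andP[].
have szp : size [seq val x | x <- p] = n by rewrite size_map size_tuple.
have nthE (l : nat) : (l < n)%N -> (nth 0 (sort leq [seq val x | x <- p]) l <= l.+1)%N
    = (l < #|level (tuple_ffun p) l.+1|)%N.
  move=> lt_ln; rewrite nth_sort_leq ?szp // count_map; congr (_ < _)%N.
  rewrite -sum1_count big_tnth -sum1_card; rewrite (reindex (cast_ord (esym (size_tuple p)))) /=.
    by apply: eq_bigl => i; rewrite inE ffunE p_gt0 /= (tnth_nth ord0) [in RHS](tnth_nth ord0).
  exists (cast_ord (size_tuple p)) => i _; exact: val_inj.
apply/forallP/forallP => [h l | h [l lt_l]].
  by have := h (cast_ord (esym szp) l); rewrite /= nthE.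
by have lt_ln : (l < n)%N; [rewrite -[n in leqRHS]szp | rewrite nthE // (h (Ordinal lt_ln))].
Qed.

Definition excedances n (p : n.-tuple 'I_n.+1) : {set 'I_n} :=
  [set i : 'I_n | (i.+1 < tnth p i)%N].

Lemma capped_level n (p : n.-tuple 'I_n.+1) (T : {set 'I_n}) :
  level (tuple_ffun p) n = setT ->
  [forall l : 'I_n, capped T l.+1 \subset level (tuple_ffun p) l.+1] = (excedances p \subset T).
Proof.
move=> lev.
have p_gt0 i : (0 < tnth p i)%N by have := in_setT i; rewrite -lev inE ffunE => /andP[].
apply/forallP/subsetP=> [capT i | excT l].
  rewrite inE; apply: contraTT => niT; rewrite -leqNgt.
  have := subsetP (capT i) i; rewrite !inE ffunE niT ltnSn p_gt0; exact.
apply/subsetP=> i; rewrite !inE ffunE p_gt0 /= => /andP[niT le_il].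
have := contra (excT i) niT; rewrite inE -leqNgt => le_i.
exact: leq_trans le_i _.
Qed.

(** In the count of pairs (i, l) with p_i <= l, position i has share n+1-p_i, so the level sizes add
    up to n(n+1) minus the sum of p, where n(n+1) is twice ['C(n.+1, 2)]. *)
Lemma cosum_level n (p : n.-tuple 'I_n.+1) :
  level (tuple_ffun p) n = setT ->
  (forall l : 'I_n, l < #|level (tuple_ffun p) l.+1|)%N ->
  cosum p = (\sum_(l < n) (#|level (tuple_ffun p) l.+1| - l.+1))%N.
Proof.
move=> lev park.
have p_gt0 i : (0 < tnth p i)%N by have := in_setT i; rewrite -lev inE ffunE => /andP[].
have S1 : (\sum_(l < n) (#|level (tuple_ffun p) l.+1| - l.+1) + \sum_(l < n) l.+1
           = \sum_(l < n) #|level (tuple_ffun p) l.+1|)%N.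
  by rewrite -big_split; apply: eq_bigr => l _; rewrite /= subnK.
have S2 : (\sum_(l < n) l.+1 = 'C(n.+1, 2))%N.
  by rewrite -bin2_sum big_nat_recl // add0n big_mkord.
have S3 : (\sum_(l < n) #|level (tuple_ffun p) l.+1| + \sum_(i < n) tnth p i = n * n.+1)%N.
  under eq_bigr => l _ do rewrite -sum1_card big_mkcond /=.
  rewrite exchange_big -big_split /= -[in RHS](card_ord n) -sum_nat_const card_ord.
  apply: eq_bigr => i _.
  rewrite -[RHS](@sum_leq_succ n (tnth p i)) ?p_gt0 //; last by rewrite ltnW // ltn_ord.
  by congr (_ + _)%N; apply: eq_bigr => l _; rewrite inE ffunE p_gt0; case: leqP.
have S4 : ('C(n.+1, 2) + 'C(n.+1, 2) = n * n.+1)%N.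
  by rewrite addnn bin2 /= (mulnC n.+1) even_halfK // oddM /= andbN.
by rewrite /cosum; move: S1 S3; rewrite S2 -S4; lia.
Qed.

(** Along the levels of p the product of the weights is the sign of p if p is parking with
    excedances in T, and 0 otherwise. *)
Lemma sum_PF_sub n (T : {set 'I_n}) :
  \sum_(p in PF n | excedances p \subset T) (-1) ^+ cosum p
  = chain_sum (cap_weight T) n setT :> int.
Proof.
rewrite -(sum_levels (N := n)) //.
have tupleK (p : n.-tuple 'I_n.+1) : [tuple tuple_ffun p i | i < n] = p.
  by apply/eq_from_tnth => i; rewrite tnth_mktuple ffunE.
rewrite (reindex_onto (@tuple_ffun n 'I_n.+1) (fun f => [tuple f i | i < n])) /=; last first.
  by move=> f _; apply/ffunP=> i; rewrite ffunE tnth_mktuple.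
rewrite [RHS](eq_bigl (fun p => level (tuple_ffun p) n == setT)) => [|p]; last first.
  by rewrite tupleK eqxx andbT andb_idl // => _; apply/forallP=> i; rewrite -ltnS ltn_ord.
rewrite (eq_bigl (fun p => (level (tuple_ffun p) n == setT) &&
   ([forall l : 'I_n, (l < #|level (tuple_ffun p) l.+1|)%N]
    && (excedances p \subset T)))); last first.
  by move=> p; rewrite inE parking_level andbA.
rewrite big_mkcondr; apply: eq_bigr => p /eqP lev.
rewrite -capped_level //; case: ifP => [/andP[/forallP park /forallP cap] | /negbT].
  rewrite cosum_level // -prodrXr; apply: eq_bigr => l _.
  by rewrite /cap_weight park cap.
rewrite negb_and !negb_forall => /orP[] /existsP[l bad_l]; rewrite (bigD1 l) //= /cap_weight.
  by rewrite (negPf bad_l) mul0r.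
by rewrite (negPf bad_l) andbF mul0r.
Qed.

(** Vandermonde's identity, after replacing the number d of elements outside E by a - d, so that the
    lower indices add up to n. *)
Lemma sum_supersets_bin n m (E : {set 'I_n}) :
  \sum_(T : {set 'I_n} | E \subset T) ('C(m, #|T|))%:R = ('C(m + n - #|E|, n))%:R :> int.
Proof.
have le_En : (#|E| <= n)%N by rewrite -[n in leqRHS]card_ord max_card.
have := sum_interval_card (fun s => ('C(m, s))%:R) (subsetT E).
rewrite (eq_bigl (fun T : {set 'I_n} => E \subset T)) => [->|T]; last by rewrite subsetT.
rewrite cardsT card_ord; set a := (n - #|E|)%N.
rewrite (_ : m + n - #|E| = a + m)%N; last by rewrite /a; lia.
rewrite -binomial.Vandermonde natr_sum (reindex_inj rev_ord_inj) /=.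
have le_an : (a.+1 <= n.+1)%N by rewrite ltnS leq_subr.
under eq_bigr => d _ do rewrite subSS bin_sub ?leq_ord // -natrM.
rewrite [RHS](bigID (fun j : 'I_n.+1 => j < a.+1)%N) /= [X in _ = _ + X]big1 ?addr0; last first.
  by move=> j; rewrite -leqNgt => lt_aj; rewrite bin_small.
rewrite (big_ord_widen _ (fun d => ('C(a, d) * 'C(m, #|E| + (a - d)))%:R) le_an).
apply: eq_bigr => d lt_d; congr (_ * 'C(_, _))%:R; rewrite /a; move: lt_d; rewrite /a; lia.
Qed.

(** The binomial is expanded over the sets T containing the excedances of p, and the sums over T and
    p are exchanged. *)
Lemma sum_PF_bin n m :
  \sum_(p in PF n.+2) (-1) ^+ cosum p * ('C(m + n.+2 - exced p, n.+2))%:R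
  = (\sum_(X < m) chains m (sum_lt m) n.+1 X)%:R :> int.
Proof.
rewrite sum_chains_sum_lt natr_sum.
under [RHS]eq_bigr => T _ do rewrite natrM -chain_sum_setT -sum_PF_sub big_distrr /= big_mkcondr.
rewrite exchange_big; apply: eq_bigr => p _.
rewrite -big_mkcond -sum_supersets_bin big_distrr /=.
by apply: eq_bigr => T _; rewrite mulrC.
Qed.

Unset Implicit Arguments.

Theorem theorem3p7 (n : nat) (hn : (2 <= n)%N) :
  \sum_(p in PF n) (-1) ^+ cosum p * 'X^(exced p) =
  \sum_(w in Alt n) 'X^((des1 (w^-1)%g).+1) :> {poly int}.
Proof.
case: n hn => [|[|n]] // _.
have exced_le (p : n.+2.-tuple 'I_n.+3) : p \in PF n.+2 -> (exced p <= n.+2)%N.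
  by move=> _; rewrite -[n.+2 in leqRHS]card_ord max_card.
have des1_lt (w : 'S_n.+2) : w \in Alt n.+2 -> ((des1 w^-1%g).+1 <= n.+2)%N.
  move=> altw; rewrite ltnS des1_label // -[n.+1 in leqRHS]card_ord -sum1_card.
  by apply: leq_sum => p _; exact: leq_b1.
rewrite (eq_bigr (fun p => ((-1) ^+ cosum p : int) *: 'X^(exced p))) => [|p _]; last first.
  by rewrite -mul_polyC rmorphXn rmorphN1.
rewrite [RHS](eq_bigr (fun w => (1 : int) *: 'X^((des1 (w^-1)%g).+1))) => [|w _]; last first.
  by rewrite scale1r.
apply: (@poly_eq_bin n.+2); [exact: size_sum_monomials | exact: size_sum_monomials |].
(* After the substitution both sides are the same number of zigzag chains. *)
move=> m; rewrite !sum_coef_bin // sum_PF_bin -sum_Alt_bin natr_sum.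
by apply: eq_bigr => w _; rewrite mul1r.
Qed.
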